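(* Let $m$, $k$, and $N$ be natural numbers with $k\geq 12$. If $m$ and $k$ are divisible by $3$, then there exists a 2-connected cubic graph $G$ with at least $N$ vertices such that no cycle of $G$ has length congruent to $m$ modulo $k$.
   Context: All graphs are finite and simple. A cubic graph is a graph in which every vertex has degree 3. *)

(* Defs.v *)
From mathcomp Require Import all_boot.

Set Implicit Arguments.
Unset Strict Implicit.
Unset Printing Implicit Defensive.

Record sgraph := SGraph {
  vertex :> finType;
  adj : rel vertex;
  adj_sym : symmetric adj;
  adj_irrefl : irreflexive adj
}.

Arguments adj {s} : rename.

Definition neighbours (G : sgraph) (x : G) : {set G} := [set y | adj x y].

Definition cubic (G : sgraph) : Prop := forall x : G, #|neighbours x| = 3.

(* The adjacency relation of G - X. *)
Definition adj_minus (G : sgraph) (X : {set G}) : rel G :=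
  [rel x y | [&& x \notin X, y \notin X & adj x y]].

Definition connected_minus (G : sgraph) (X : {set G}) : Prop :=
  forall x y : G, x \notin X -> y \notin X -> connect (adj_minus X) x y.

(* G has more than d vertices, and deleting fewer than d vertices never
   disconnects it; d = 2 gives 2-connectedness. *)
Definition vertex_connected (d : nat) (G : sgraph) : Prop :=
  d < #|G| /\ forall X : {set G}, #|X| < d -> connected_minus X.

(* A cycle is given by the list of its vertices in cyclic order; ucycle by
   itself also accepts the empty list and a single edge [:: x; y], whence the
   bound on the size. The length of the cycle is size c. *)
Definition is_cycle (G : sgraph) (c : seq G) : Prop :=
  2 < size c /\ ucycle adj c.

(* Main.v *)
(** Call a graph with two terminals of degree 2, all other vertices having
degree 3, a gadget; two gadgets joined by two edges between their terminals form
a ring. A cycle of a graph with a 2-edge cut either stays on one side or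
consists of one path through each side, so only the numbers l of vertices of the
terminal-to-terminal paths matter.

Wrapping a gadget in an edge uv (each terminal attached to one of u, v) replaces
l by 2 or 2 + l and creates cycles of length 2 + l. Attaching it to two opposite
vertices of a 4-cycle replaces l by 3 or 4 + l and creates cycles of length 4 or
3 + l. If every l is 0 modulo 3 except for one exact value z = 2 modulo 3, then
wrapping followed by crossing creates no cycle of length divisible by 3 and
preserves this property, with z + 6 instead of z. Hence, apart from the cycles of
the initial gadget, the only length divisible by 3 in the ring obtained after n
such steps is 6n + 2z + 2, and n can be chosen to avoid m modulo k.

The initial gadget consists of two parallel copies of K4 minus an edge, with
z = 5 and cycle lengths 3, 4, 8, 9, 10, or, when m is 3 or 9 modulo k, of
K_{3,3} minus an edge, with z = 8 and cycle lengths 4, 6, 10, 12, 14. *)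

Require Import Defs.
From mathcomp Require Import all_boot zify.

Set Implicit Arguments.
Unset Strict Implicit.
Unset Printing Implicit Defensive.

(** * Gadgets, and lengths of paths and cycles *)

Record gadget := Gadget {
  gadget_graph :> sgraph;
  src : gadget_graph;
  tgt : gadget_graph;
  src_neq_tgt : src != tgt
}.

Arguments src {g}.
Arguments tgt {g}.

(** The number [n] counts vertices, not edges, so that two paths joined at their ends by two links
    form a cycle whose length is the plain sum. *)
Definition spath (G : sgraph) (x y : G) (n : nat) : Prop :=
  exists p : seq G,
    [/\ path adj x p, last x p = y, uniq (x :: p) & n = (size p).+1].

Definition has_cycle (G : sgraph) (n : nat) : Prop :=
  exists2 c : seq G, is_cycle c & n = size c.

Lemma last_uniq_nil (T : eqType) (x : T) p : last x p = x -> uniq (x :: p) -> p = [::].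
Proof. by case: p => //= y p lp; rewrite -{1}lp mem_last. Qed.

Lemma spath_refl (G : sgraph) (x : G) n : spath x x n -> n = 1.
Proof. by case=> p [_ lp up ->]; rewrite (last_uniq_nil lp up). Qed.

Lemma spath_sym (G : sgraph) (x y : G) n : spath x y n -> spath y x n.
Proof.
case=> p [pp lp up ->]; exists (rev (belast x p)).
have Ep : y :: rev (belast x p) = rev (x :: p).
  by rewrite [in RHS]lastI rev_rcons lp.
split.
- rewrite -lp rev_path; apply: sub_path pp => u v /=.
  by rewrite adj_sym.
- case: p {pp up Ep} lp => [|z p] //= <-.
  by rewrite rev_cons last_rcons.
- by rewrite Ep rev_uniq.
- by rewrite size_rev size_belast.
Qed.

Lemma is_cycle_rot (G : sgraph) n (c : seq G) : is_cycle c -> is_cycle (rot n c).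
Proof.
case=> sc /andP[cc uc]; split; rewrite ?size_rot //.
by rewrite /ucycle rot_cycle rot_uniq cc.
Qed.

Lemma sum_eq_op (T : finType) (x : T) : \sum_y (y == x) = 1.
Proof. by rewrite (bigD1 x) //= eqxx big1 // => y /negbTE->. Qed.

Lemma card_neighbours (G : sgraph) (x : G) : #|neighbours x| = \sum_y adj x y.
Proof. by rewrite cardsE -sum1_card big_mkcond. Qed.

(** * Gluing two graphs by two links: paths, cycles and degrees *)

Section Glue.

Variables (H A : sgraph) (a b : H) (s t : A).
Hypotheses (ab : a != b) (st : s != t).

Definition link (x : H) (y : A) : bool :=
  (x == a) && (y == s) || (x == b) && (y == t).

Definition glue_adj (u v : H + A) : bool :=
  match u, v with
  | inl x, inl y => adj x y
  | inr x, inr y => adj x y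
  | inl x, inr y => link x y
  | inr y, inl x => link x y
  end.

Lemma glue_adj_sym : symmetric glue_adj.
Proof. by move=> [x|x] [y|y] //=; rewrite adj_sym. Qed.

Lemma glue_adj_irrefl : irreflexive glue_adj.
Proof. by move=> [x|x] /=; rewrite adj_irrefl. Qed.

Definition glue_graph : sgraph := SGraph glue_adj_sym glue_adj_irrefl.

Lemma link_eqr x y z : link x y -> link x z -> y = z.
Proof.
case/orP=> /andP[/eqP-> /eqP->]; case/orP=> /andP[/eqP e /eqP->] //.
  by move: ab; rewrite e eqxx.
by move: ab; rewrite e eqxx.
Qed.

Lemma link_or x y z x' y' z' :
  link x x' -> link y y' -> link z z' -> x != y -> x != z -> y = z.
Proof.
by move=> /orP[]/andP[/eqP-> _] /orP[]/andP[/eqP-> _] /orP[]/andP[/eqP-> _];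
  rewrite ?eqxx.
Qed.

Lemma split_inl (p : seq (H + A)) : exists q p', p = map inl q ++ p' /\
  (p' = [::] \/ exists z p'', p' = inr z :: p'').
Proof.
elim: p => [|[x|z] p [q [p' [-> Hp']]]].
- by exists [::], [::]; split; [|left].
- by exists (x :: q), p'.
- by exists [::], (inr z :: map inl q ++ p'); split=> //; right; exists z; eexists.
Qed.

Lemma split_inr (p : seq (H + A)) : exists r p', p = map inr r ++ p' /\
  (p' = [::] \/ exists z p'', p' = inl z :: p'').
Proof.
elim: p => [|[z|x] p [q [p' [-> Hp']]]].
- by exists [::], [::]; split; [|left].
- by exists [::], (inl z :: map inr q ++ p'); split=> //; right; exists z; eexists.
- by exists (x :: q), p'.
Qed.

Lemma path_inl x (q : seq H) :
  path glue_adj (inl x) (map inl q) = path adj x q.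
Proof. by elim: q x => //= y q IH x; rewrite IH. Qed.

Lemma path_inr x (q : seq A) :
  path glue_adj (inr x) (map inr q) = path adj x q.
Proof. by elim: q x => //= y q IH x; rewrite IH. Qed.

Lemma inl_inj : injective (@inl H A). Proof. by move=> x y []. Qed.
Lemma inr_inj : injective (@inr H A). Proof. by move=> x y []. Qed.

(* A simple path cannot enter A a second time: leaving A uses up both links. *)
Lemma glue_path_shape x (p : seq (H + A)) :
    path glue_adj (inl x) p -> uniq (inl x :: p) ->
  exists q r q', p = map inl q ++ map inr r ++ map inl q' /\ path adj x q /\
    match r with
    | [::] => q' = [::]
    | z :: r' => [/\ link (last x q) z, path adj z r' &
        if q' is y :: q'' then link y (last z r') /\ path adj y q'' else True]
    end.
Proof.
have [q [p1 [-> [->|[z [p2 ->]]]]]] := split_inl p.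
  by rewrite cats0 path_inl => pq _; exists q, [::], [::]; rewrite /= cats0.
have [r [p3 [-> [->|[y [p4 ->]]]]]] := split_inr p2.
  rewrite cats0 cat_path /= path_inl last_map path_inr => /and3P[pq lz pr] _.
  by exists q, (z :: r), [::]; rewrite /= cats0.
have [q' [p5 [-> [->|[w [p6 ->]]]]]] := split_inl p4.
  rewrite cats0 cat_path /= path_inl last_map cat_path /= path_inr last_map path_inl.
  case/and5P=> pq lz pr ly pq' _; by exists q, (z :: r), (y :: q').
rewrite cat_path /= path_inl last_map cat_path /= path_inr last_map.
rewrite cat_path /= path_inl last_map.
case/and5P=> pq lz pr ly /and3P[pq' lw _] U; exfalso.
have {}U : uniq (map inl (x :: q) ++ map inr (z :: r) ++ map inl (y :: q') ++ inr w :: p6) by [].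
rewrite cat_uniq in U; case/and3P: U => _ U1.
rewrite cat_uniq => /and3P[_ U2 _].
have N1 v : v \in y :: q' -> last x q != v.
  move=> vq; apply: contra U1 => /eqP e; apply/hasP; exists (inl v).
    by rewrite !mem_cat (map_f inl vq) orbT.
  by apply: (map_f inl); rewrite -e mem_last.
have N2 : last z r != w.
  apply: contra U2 => /eqP e; apply/hasP; exists (inr w).
    by rewrite !mem_cat mem_head !orbT.
  by apply: (map_f inr); rewrite -e mem_last.
(* The first exit from [H] uses up one of [a], [b], so the second stretch in [H] starts and ends at
   the other one. The link entering that stretch is then also the link leaving it, which repeats a
   vertex of [A]. *)
have e := link_or lz ly lw (N1 _ (mem_head _ _)) (N1 _ (mem_last _ _)).
by rewrite -e in lw; rewrite (link_eqr ly lw) eqxx in N2.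
Qed.

(** The two links are either different, which gives terminal paths up to reversal, or equal, in
    which case both paths are single vertices. The bound [2 < m + n] excludes the latter. *)
Lemma link_spath x y u v m n : link x u -> link y v ->
  spath x y m -> spath u v n -> 2 < m + n -> spath a b m /\ spath s t n.
Proof.
move=> /orP[]/andP[/eqP-> /eqP->] /orP[]/andP[/eqP-> /eqP->] // Hm Hn.
- by rewrite (spath_refl Hm) (spath_refl Hn).
- by move=> _; split; apply: spath_sym.
- by rewrite (spath_refl Hm) (spath_refl Hn).
Qed.

Lemma glue_cycle n : has_cycle glue_graph n ->
  [\/ has_cycle H n, has_cycle A n |
   exists n1 n2, [/\ spath a b n1, spath s t n2 & n = n1 + n2]].
Proof.
case=> c Hc ->.
have [r [p' [Ec [e|[x [p'' e]]]]]] := split_inr c; subst p'.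
  constructor 2; rewrite cats0 in Ec; subst c; exists r; last by rewrite size_map.
  case: Hc; rewrite size_map => sc /andP[]; rewrite (map_inj_uniq inr_inj) => cc uc.
  split=> //; rewrite /ucycle uc andbT.
  by case: r cc {sc uc} => //= z r; rewrite -map_rcons path_inr.
(* The cycle meets [H], so it can be rotated to start there, as the description of paths
   requires. *)
have {Hc Ec}[p Hc ->] : exists2 p, is_cycle (inl x :: p : seq glue_graph) & size c = (size p).+1.
  exists (p'' ++ map inr r); last by rewrite Ec !size_cat /= addnC addSn.
  by rewrite -cat_cons -rot_size_cat -Ec; apply: is_cycle_rot.
case: Hc => sc /andP[]; rewrite /= rcons_path => /andP[pp lx] up.
have [q [z0 [q' [Ep [pq]]]]] := glue_path_shape pp up.
case: z0 Ep => [|z r'] Ep.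
  move=> e; subst q'; rewrite /= cats0 in Ep; subst p; constructor 1.
  exists (x :: q); last by rewrite /= size_map.
  move: sc lx up; rewrite /= size_map last_map /= => sc lx.
  rewrite (mem_map inl_inj) (map_inj_uniq inl_inj) => up.
  by split; rewrite // /ucycle /= rcons_path pq lx up.
case=> lz pr Hq'; subst p; constructor 3.
have {}up : uniq (map inl (x :: q) ++ map inr (z :: r') ++ map inl q' : seq (H + A)) by [].
have ur : uniq (z :: r').
  move: up; rewrite cat_uniq => /and3P[_ _]; rewrite cat_uniq => /and3P[+ _ _].
  by rewrite (map_inj_uniq inr_inj).
have uq : uniq (q' ++ x :: q).
  move: up; rewrite catA uniq_catC catA -map_cat cat_uniq => /and3P[+ _ _].
  by rewrite (map_inj_uniq inl_inj).
have Hr : spath z (last z r') (size r').+1 by exists r'.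
(* The start [x] may lie in the middle of the stretch in [H]: read cyclically, that stretch is [q']
   followed by [x :: q]. *)
suff [y ly Hy] : exists2 y, link y (last z r') & spath y (last x q) (size q' + (size q).+1).
  exists (size q' + (size q).+1), (size r').+1.
  have [] := link_spath ly lz Hy (spath_sym Hr).
    by move: sc; rewrite /= ?size_cat /= ?size_cat ?size_map; lia.
  by split=> //; rewrite ?size_cat /= ?size_cat ?size_map; lia.
case: q' Hq' {up} uq lx {pp sc} => [_ uq|y q' [ly pq'] uq].
  rewrite cats0 last_cat last_map /= last_map /= => lx.
  by exists x => //; exists q.
rewrite !last_cat /= last_map /= => lx.
exists y => //; exists (q' ++ x :: q); split=> //.
- by rewrite cat_path /= pq' lx.
- by rewrite last_cat.
- by rewrite size_cat.
Qed.

(** A path with both ends in [H] visits [A] at most once, entering by one link and leaving by the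
    other, so the visit is a terminal path of [A]. *)
Lemma glue_spath c d n : @spath glue_graph (inl c) (inl d) n ->
  spath c d n \/
  exists x y q q' n', [/\ (x, y) = (a, b) \/ (x, y) = (b, a),
    last c q = x /\ last y q' = d, uniq (c :: q ++ y :: q'),
    spath s t n' & n = size (c :: q ++ y :: q') + n'].
Proof.
case=> p [pp lp up ->].
have [q [z0 [q' [Ep [pq]]]]] := glue_path_shape pp up.
case: z0 Ep => [|z r'] Ep.
  move=> e; subst q'; rewrite /= cats0 in Ep; subst p; left.
  move: lp up; rewrite last_map /= (mem_map inl_inj) (map_inj_uniq inl_inj) => -[lq] uq.
  by exists q; rewrite size_map.
case=> lz pr Hq'; subst p; right.
have {}up : uniq (map inl (c :: q) ++ map inr (z :: r') ++ map inl q' : seq (H + A)) by [].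
have ur : uniq (z :: r').
  move: up; rewrite cat_uniq => /and3P[_ _]; rewrite cat_uniq => /and3P[+ _ _].
  by rewrite (map_inj_uniq inr_inj).
have uq : uniq (c :: q ++ q').
  move: up; rewrite catA uniq_catC catA -map_cat cat_uniq => /and3P[+ _ _].
  by rewrite (map_inj_uniq inl_inj) uniq_catC.
move: lp; rewrite !last_cat last_map /= last_map.
case: q' Hq' {pp up} uq => // y q' [ly pq'] uq /=; rewrite last_map => -[lq'].
have nxy : last c q != y.
  apply: contraTneq uq => <-; rewrite -cat_cons cat_uniq !negb_and /= mem_last.
  by rewrite orbT.
have Hr : spath z (last z r') (size r').+1 by exists r'.
exists (last c q), y, q, q', (size r').+1; split=> //.
- by move: lz ly nxy => /orP[]/andP[/eqP-> _] /orP[]/andP[/eqP-> _]; rewrite ?eqxx; auto.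
- move: lz ly nxy Hr => /orP[]/andP[/eqP-> /eqP->] /orP[]/andP[/eqP-> /eqP->]; rewrite ?eqxx //.
  by move=> _; apply: spath_sym.
- by rewrite !size_cat /= !size_cat /= !size_map; lia.
Qed.

(** A detour that starts at [a] and leaves [H] from [a] must leave at once, and likewise must end on
    re-entering at [b]. Leaving from [b] and re-entering at [a] would repeat [a]. *)
Lemma glue_spath_terminals n : @spath glue_graph (inl a) (inl b) n ->
  spath a b n \/ exists2 n', spath s t n' & n = 2 + n'.
Proof.
case/glue_spath=> [|[x [y [q [q' [n' [xy [lq lq'] uq Hn' ->]]]]]]]; [by left|right].
exists n' => //; case: xy lq lq' uq => -[-> ->] lq lq' uq.
  move: uq; rewrite -cat_cons cat_uniq => /and3P[uq _ uq'].
  by rewrite (last_uniq_nil lq uq) (last_uniq_nil lq' uq').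
by move: uq; rewrite /= mem_cat mem_head orbT.
Qed.

(** A detour passes through [a], [b] and both ends [c], [d], hence through all four vertices of
    [H]. *)
Lemma glue_spath_four c d n : #|H| = 4 -> uniq [:: a; b; c; d] ->
    @spath glue_graph (inl c) (inl d) n ->
  spath c d n \/ exists2 n', spath s t n' & n = 4 + n'.
Proof.
move=> cardH u4.
case/glue_spath=> [|[x [y [q [q' [n' [xy [lq lq'] uq Hn' ->]]]]]]]; [by left|right].
exists n' => //; congr (_ + _); apply/eqP; rewrite eqn_leq.
rewrite -{1}cardH -(card_uniqP uq) max_card (card_uniqP uq).
apply: (uniq_leq_size u4) => v.
have xq : x \in c :: q ++ y :: q' by rewrite -cat_cons mem_cat -lq mem_last.
have yq : y \in c :: q ++ y :: q' by rewrite inE mem_cat mem_head !orbT.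
have dq : d \in c :: q ++ y :: q' by rewrite inE mem_cat -lq' mem_last !orbT.
rewrite !inE => /or4P[] /eqP-> //; try by rewrite ?eqxx.
- by case: xy xq yq => -[-> ->].
- by case: xy xq yq => -[-> ->].
Qed.

Lemma card_glue : #|glue_graph| = #|H| + #|A|.
Proof. exact: card_sum. Qed.

Lemma glue_degree_inl (x : H) :
  #|neighbours (inl x : glue_graph)| = #|neighbours x| + (x == a) + (x == b).
Proof.
rewrite !card_neighbours /= big_sumType /= -addnA; congr (_ + _).
transitivity (\sum_y ((y == s) * (x == a) + (y == t) * (x == b))).
  apply: eq_bigr => y _; rewrite /link.
  case: (x =P a) => [xa|_]; case: (x =P b) => [xb|_]; rewrite ?orbF ?muln1 ?muln0 ?addn0 //.
  by move: ab; rewrite -xa -xb eqxx.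
by rewrite big_split /= -!big_distrl /= !sum_eq_op; lia.
Qed.

Lemma glue_degree_inr (y : A) :
  #|neighbours (inr y : glue_graph)| = #|neighbours y| + (y == s) + (y == t).
Proof.
rewrite !card_neighbours /= big_sumType /= -addnA addnC; congr (_ + _).
transitivity (\sum_x ((x == a) * (y == s) + (x == b) * (y == t))).
  apply: eq_bigr => x _; rewrite /link.
  case: (y =P s) => [ys|_]; case: (y =P t) => [yt|_];
    rewrite ?andbT ?andbF ?orbF ?muln1 ?muln0 ?addn0 //.
  by move: st; rewrite -ys -yt eqxx.
by rewrite big_split /= -!big_distrl /= !sum_eq_op; lia.
Qed.

(* As long as A is intact, it acts like an edge between a and b. *)
Definition frame_adj (X : {set H}) : rel H := [rel x y | [&& x \notin X, y \notin X &
  [|| adj x y, (x == a) && (y == b) | (x == b) && (y == a)]]].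

Variables c d : H.

(** These conditions on [H] make the glued gadget 2-connected in the sense of [gadget_2conn]. The
    second serves deletions in [H], where the intact [A] replaces an edge; the third serves
    deletions in [A], where that edge is lost. *)
Definition frame_2conn : Prop :=
  [/\ connect (frame_adj set0) c d,
      (forall (X : {set H}) y, #|X| <= 1 -> y \notin X ->
        exists2 u, u \in [:: c; d] & u \notin X /\ connect (frame_adj X) y u)
    & forall y, exists2 u, u \in [:: c; d] & connect adj y u].

End Glue.

(** * 2-connectedness of glued graphs *)

Lemma connect_homo (T T' : finType) (e : rel T) (e' : rel T') (f : T -> T') :
    (forall x y, e x y -> connect e' (f x) (f y)) ->
  forall x y, connect e x y -> connect e' (f x) (f y).
Proof.
move=> He x y /connectP[p pp ->]; elim: p x pp => [|z p IH] x //= /andP[xz zp].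
exact: connect_trans (He _ _ xz) (IH _ zp).
Qed.

Lemma adj_minus_sym (G : sgraph) (X : {set G}) : connect_sym (adj_minus X).
Proof.
apply: sym_connect_sym => x y; rewrite /adj_minus /= [adj x y]adj_sym.
by case: (x \in X); case: (y \in X).
Qed.

Lemma adj_minus0 (G : sgraph) (x y : G) : adj_minus set0 x y = adj x y.
Proof. by rewrite /adj_minus /= !inE. Qed.

(** This is what a gadget contributes to a 2-connected graph in which its terminals are also joined
    from outside: after a deletion every remaining vertex can still get out. *)
Definition gadget_2conn (A : gadget) : Prop :=
  connect (@adj A) src tgt /\
  (forall (X : {set A}) y, #|X| <= 1 -> y \notin X ->
     exists2 u, u \in [:: src; tgt] & u \notin X /\ connect (adj_minus X) y u).

Lemma gadget_connected (A : gadget) : gadget_2conn A -> forall x y : A, connect adj x y.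
Proof.
case=> st R.
have sym : connect_sym (@adj A) by apply: sym_connect_sym; apply: adj_sym.
suff Hs x : connect adj x (@src A).
  by move=> x y; apply: connect_trans (Hs x) _; rewrite sym.
have [||u ust [_]] := R set0 x; rewrite ?cards0 ?inE //.
rewrite (eq_connect (@adj_minus0 A)) => xu; apply: connect_trans xu _.
by move: ust; rewrite !inE => /orP[]/eqP-> //; rewrite sym.
Qed.

Section GlueConnectivity.

Variables (H A : sgraph) (a b : H) (s t : A).

Let G := glue_graph a b s t.
Variable X : {set G}.

Let Xl := [set x : H | inl x \in X].
Let Xr := [set y : A | inr y \in X].

Lemma glue_removed : #|X| <= 1 ->
  Xr = set0 /\ #|Xl| <= 1 \/ Xl = set0 /\ #|Xr| <= 1.
Proof.
move=> cX.
have /eqP E : #|X| == #|Xl| + #|Xr|.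
  by rewrite /Xl /Xr !cardsE -!sum1_card big_sumType.
have [e|] := eqVneq Xr set0; first by left; split=> //; lia.
rewrite -card_gt0 => c0; right; split; last by lia.
by apply/eqP; rewrite -cards_eq0; lia.
Qed.

Lemma connect_inl x y : connect (adj_minus Xl) x y ->
  connect (@adj_minus G X) (inl x) (inl y).
Proof.
apply: connect_homo => u v /and3P[]; rewrite !inE => uX vX uv.
by apply: connect1; rewrite /adj_minus /= uX vX.
Qed.

Lemma connect_inr x y : connect (adj_minus Xr) x y ->
  connect (@adj_minus G X) (inr x) (inr y).
Proof.
apply: connect_homo => u v /and3P[]; rewrite !inE => uX vX uv.
by apply: connect1; rewrite /adj_minus /= uX vX.
Qed.

Lemma connect_link x y : link a b s t x y -> x \notin Xl -> y \notin Xr ->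
  connect (@adj_minus G X) (inl x) (inr y).
Proof. by rewrite !inE => xy xX yX; apply: connect1; rewrite /adj_minus /= xX yX. Qed.

Lemma link_src : link a b s t a s. Proof. by rewrite /link !eqxx. Qed.
Lemma link_tgt : link a b s t b t. Proof. by rewrite /link !eqxx orbT. Qed.

Lemma connect_frame (Acon : forall x y : A, connect adj x y) x y : Xr = set0 ->
  connect (frame_adj a b Xl) x y -> connect (@adj_minus G X) (inl x) (inl y).
Proof.
move=> Xr0; apply: connect_homo => u v /and3P[uX vX].
have aux u' v' y1 y2 : u' \notin Xl -> v' \notin Xl ->
    link a b s t u' y1 -> link a b s t v' y2 -> connect (@adj_minus G X) (inl u') (inl v').
  move=> uX' vX' l1 l2; apply: connect_trans (connect_link l1 uX' _) _.
    by rewrite Xr0 inE.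
  apply: (@connect_trans G _ (inr y2)); last first.
    by rewrite adj_minus_sym; apply: connect_link => //; rewrite Xr0 inE.
  by apply: connect_inr; rewrite Xr0 (eq_connect (@adj_minus0 A)).
case/or3P=> [uv|/andP[/eqP eu /eqP ev]|/andP[/eqP eu /eqP ev]].
- by apply: connect_inl; apply: connect1; rewrite /adj_minus /= uX vX.
- by apply: (aux _ _ s t) => //; rewrite ?eu ?ev ?link_src ?link_tgt.
- by apply: (aux _ _ t s) => //; rewrite ?eu ?ev ?link_src ?link_tgt.
Qed.

Lemma connect_terminal y : s != t -> y \in [:: s; t] -> Xl = set0 -> y \notin Xr ->
  exists x, connect (@adj_minus G X) (inr y) (inl x).
Proof.
move=> st Hy Xl0 yX; exists (if y == s then a else b).
rewrite adj_minus_sym; apply: connect_link => //; last by rewrite Xl0 inE.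
by move: Hy; rewrite !inE => /orP[]/eqP->; rewrite ?eqxx ?link_src // eq_sym (negbTE st) link_tgt.
Qed.

End GlueConnectivity.

Definition glue (H A : gadget) (a b : H) : gadget :=
  @Gadget (glue_graph a b (@src A) (@tgt A)) (inl src) (inl tgt) (src_neq_tgt H).

Lemma glue_2conn (H A : gadget) (a b : H) : a != b ->
  frame_2conn a b (@src H) tgt -> gadget_2conn A -> gadget_2conn (glue A a b).
Proof.
move=> ab [S1 S2 S3] GA; have Acon := gadget_connected GA.
case: (GA) => _ R.
have stA := src_neq_tgt A.
split.
  rewrite -(eq_connect (@adj_minus0 (glue A a b))).
  apply: (connect_frame Acon); first by apply/setP=> y; rewrite !inE.
  rewrite (_ : [set _ | _] = set0) //; by apply/setP=> y; rewrite !inE.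
move=> X y cX yX.
have lift u : u \in [:: src; tgt] -> inl u \in [:: @src (glue A a b); tgt].
  by move=> Hu; apply: (map_f inl Hu).
case: (glue_removed cX) => -[X0 cX'].
  have Hl x : inl x \notin X -> exists2 u, u \in [:: @src (glue A a b); tgt] &
      u \notin X /\ connect (@adj_minus (glue A a b) X) (inl x) u.
    move=> xX; case: (S2 [set x | inl x \in X] x); rewrite ?inE // => u Hu [].
    rewrite inE => uX xu; exists (inl u); first exact: lift.
    by split=> //; apply: connect_frame.
  case: y yX => [x|y] yX; first exact: Hl.
  (* At most one vertex is deleted, so [a] or [b] survives and offers an exit from the intact
     [A]. *)
  have [x [z [xz xX]]] : exists x z, link a b (@src A) tgt x z /\ inl x \notin X.
    case: (boolP (inl a \in X)) => [aX|]; last by exists a, src; rewrite link_src.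
    exists b, tgt; rewrite link_tgt; split=> //; apply: contra ab => bX.
    by apply/eqP; apply: (card_le1_eqP cX'); rewrite inE.
  have [u Hu [uX xu]] := Hl x xX; exists u => //; split=> //.
  apply: connect_trans xu.
  apply: (@connect_trans (glue A a b) _ (inr z)).
    by apply: connect_inr; rewrite X0 (eq_connect (@adj_minus0 A)).
  by rewrite adj_minus_sym; apply: connect_link => //; rewrite ?X0 !inE.
(* Now [H] is intact, but its vertices must reach the terminals without any detour through [A]. *)
have Hl x : exists2 u, u \in [:: @src (glue A a b); tgt] &
    u \notin X /\ connect (@adj_minus (glue A a b) X) (inl x) u.
  have [u Hu xu] := S3 x; exists (inl u); first exact: lift.
  split; first by have := in_set0 u; rewrite -X0 inE => ->.
  by apply: connect_inl; rewrite X0 (eq_connect (@adj_minus0 H)).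
case: y yX => [x|y] yX; first exact: Hl.
have [|z Hz [zX yz]] := R [set y | inr y \in X] y cX'; first by rewrite inE.
have [x zx] := connect_terminal stA Hz X0 zX.
have [u Hu [uX xu]] := Hl x; exists u => //; split=> //.
by apply: connect_trans xu; apply: connect_trans zx; apply: connect_inr.
Qed.

Lemma glue_vertex_connected (H A : gadget) : gadget_2conn H -> gadget_2conn A ->
  vertex_connected 2 (glue A (@src H) tgt).
Proof.
move=> GH GA; have Hcon := gadget_connected GH; have Acon := gadget_connected GA.
have stH := src_neq_tgt H; have stA := src_neq_tgt A.
split.
  rewrite card_glue.
  have : 1 < #|H| by apply/card_gt1P; exists src, tgt.
  have : 1 < #|A| by apply/card_gt1P; exists src, tgt.
  lia.
move=> X; rewrite ltnS => cX.
(* Reachability is symmetric, so a common target suffices; it is taken on the side that loses no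
   vertex. *)
suff [w Hw] : exists w, forall x, x \notin X ->
    connect (@adj_minus (glue A (@src H) tgt) X) x w.
  by move=> x y xX yX; apply: connect_trans (Hw x xX) _; rewrite adj_minus_sym Hw.
case: (glue_removed cX) => -[X0 cX'].
  exists (inr src).
  have Hr y : connect (@adj_minus (glue A (@src H) tgt) X) (inr y) (inr src).
    by apply: connect_inr; rewrite X0 (eq_connect (@adj_minus0 A)).
  move=> [x|y] xX //.
  have [|u Hu [uX xu]] := GH.2 _ x cX'; first by rewrite inE.
  apply: connect_trans (connect_inl xu) _.
  apply: connect_trans (Hr (if u == src then src else tgt)).
  apply: connect_link; [|by []|by rewrite X0 inE].
  move: Hu; rewrite !inE => /orP[]/eqP->; rewrite ?eqxx ?link_src //.
  by rewrite eq_sym (negbTE stH) link_tgt.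
exists (inl src).
have Hl x : connect (@adj_minus (glue A (@src H) tgt) X) (inl x) (inl src).
  by apply: connect_inl; rewrite X0 (eq_connect (@adj_minus0 H)).
move=> [x|y] yX //.
have [|z Hz [zX yz]] := GA.2 _ y cX'; first by rewrite inE.
have [x zx] := connect_terminal stA Hz X0 zX.
by apply: connect_trans (Hl x); apply: connect_trans zx; apply: connect_inr.
Qed.

(** * Degrees in glued gadgets *)

(** The two indicator terms stand for the link that each terminal has yet to receive. *)
Definition cubic_gadget (A : gadget) : Prop :=
  forall x : A, #|neighbours x| + (x == src) + (x == tgt) = 3.

Lemma glue_cubic_gadget (H A : gadget) (a b : H) : a != b ->
    (forall x : H, #|neighbours x| + (x == a) + (x == b) + (x == src) + (x == tgt) = 3) ->
  cubic_gadget A -> cubic_gadget (glue A a b).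
Proof.
move=> ab cH cA [x|y].
  by rewrite glue_degree_inl ?src_neq_tgt // -[RHS](cH x).
by rewrite glue_degree_inr ?src_neq_tgt // !addn0 cA.
Qed.

Lemma glue_cubic (H A : gadget) : cubic_gadget H -> cubic_gadget A ->
  cubic (glue A (@src H) tgt).
Proof.
move=> cH cA [x|y]; first by rewrite glue_degree_inl ?src_neq_tgt.
by rewrite glue_degree_inr ?src_neq_tgt.
Qed.

(** * Wrapping in an edge, and two parallel copies *)

Section Wrap.

Variable w : bool.

(** For [w = true] this is the edge used for wrapping; for [w = false] it is two isolated vertices,
    used to put two copies of a gadget in parallel. *)
Definition pair_adj : rel bool := [rel x y | w && (x != y)].

Lemma pair_adj_sym : symmetric pair_adj.
Proof. by move=> x y; rewrite /pair_adj /= eq_sym. Qed.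

Lemma pair_adj_irrefl : irreflexive pair_adj.
Proof. by move=> x; rewrite /pair_adj /= eqxx andbF. Qed.

Definition pair_graph : sgraph := SGraph pair_adj_sym pair_adj_irrefl.

Definition pair_gadget : gadget := @Gadget pair_graph true false isT.

Definition wrap (A : gadget) : gadget := glue A (@src pair_gadget) tgt.

Lemma pair_spath n : @spath pair_graph true false n -> w /\ n = 2.
Proof.
case=> p [pp lp up ->].
have := max_card [in true :: p]; rewrite (card_uniqP up) card_bool.
case: p pp lp {up} => [|x [|y p]] //= /andP[+ _] _ _.
by rewrite /pair_adj /= => /andP[].
Qed.

Lemma pair_cycle n : ~ has_cycle pair_graph n.
Proof.
case=> c [sc /andP[_ uc]] _.
by have := max_card [in c]; rewrite (card_uniqP uc) card_bool leqNgt sc.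
Qed.

Lemma pair_terminal (x : bool) : x \in [:: true; false].
Proof. by case: x. Qed.

Lemma wrap_2conn A : gadget_2conn A -> gadget_2conn (wrap A).
Proof.
apply: glue_2conn => //; split.
- by apply: connect1; rewrite /frame_adj /= !in_set0 orbT.
- by move=> X y _ yX; exists y; rewrite ?pair_terminal.
- by move=> y; exists y; rewrite ?pair_terminal.
Qed.

Lemma card_wrap A : #|wrap A| = 2 + #|A|.
Proof. by rewrite card_glue card_bool. Qed.

Lemma wrap_spath A n : @spath (wrap A) src tgt n ->
  w /\ n = 2 \/ exists2 n', @spath A src tgt n' & n = 2 + n'.
Proof.
case/(glue_spath_terminals (src_neq_tgt pair_gadget) (src_neq_tgt A)) => [/pair_spath|]; [by left|by right].
Qed.

Lemma wrap_cycle A n : has_cycle (wrap A) n ->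
  has_cycle A n \/ w /\ exists2 n', @spath A src tgt n' & n = 2 + n'.
Proof.
case/(glue_cycle (src_neq_tgt pair_gadget) (src_neq_tgt A)) => [/pair_cycle//| |]; first by left.
by case=> n1 [n2 [/pair_spath[ww ->] H2 ->]]; right; split=> //; exists n2.
Qed.

End Wrap.

Lemma wrap_cubic_gadget A : cubic_gadget A -> cubic_gadget (wrap true A).
Proof. by apply: glue_cubic_gadget => // x; rewrite card_neighbours big_bool; case: x. Qed.

(** The extra edge of the frame can only add connections, so all conditions are inherited from [H]
    itself. *)
Lemma frame_2conn_terminals (H : gadget) : gadget_2conn H ->
  frame_2conn (@src H) tgt src tgt.
Proof.
move=> GH; have [_ R] := GH; have Hcon := gadget_connected GH.
have sub (X : {set H}) : subrel (connect (adj_minus X)) (connect (frame_adj src tgt X)).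
  apply: connect_sub => x y /and3P[xX yX xy]; apply: connect1.
  by rewrite /frame_adj /= xX yX xy.
split.
- by apply: sub; rewrite (eq_connect (@adj_minus0 H)).
- move=> X y cX yX; have [u Hu [uX yu]] := R X y cX yX.
  by exists u => //; split=> //; apply: sub.
- by move=> y; exists src; rewrite ?mem_head.
Qed.

(** [wrap false D] hangs one copy of [D] between two new nonadjacent vertices; the second copy is
    attached to the same two vertices, which are the new terminals. *)
Definition double (D : gadget) : gadget := glue D (@src (wrap false D)) tgt.

Lemma double_2conn D : gadget_2conn D -> gadget_2conn (double D).
Proof.
move=> GD; apply: glue_2conn => //.
by apply: frame_2conn_terminals; apply: wrap_2conn.
Qed.

Lemma double_cubic_gadget D : cubic_gadget D -> cubic_gadget (double D).
Proof.
move=> cD; apply: glue_cubic_gadget => //.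
move=> [x|y]; last by rewrite glue_degree_inr ?src_neq_tgt // !addn0 cD.
rewrite glue_degree_inl ?src_neq_tgt // card_neighbours big_bool.
by case: x.
Qed.

Lemma double_spath D n : @spath (double D) src tgt n ->
  exists2 n', @spath D src tgt n' & n = 2 + n'.
Proof.
by case/(glue_spath_terminals (src_neq_tgt _) (src_neq_tgt _)) => // /wrap_spath[[]|].
Qed.

Lemma double_cycle D n : has_cycle (double D) n ->
  has_cycle D n \/
  exists n1 n2, [/\ @spath D src tgt n1, @spath D src tgt n2 & n = 2 + n1 + n2].
Proof.
case/(glue_cycle (src_neq_tgt _) (src_neq_tgt _)) => [/wrap_cycle[|[]]//| |]; try by left.
case=> n1 [n2 [/wrap_spath[[]//|[n1' H1 ->]] H2 ->]].
by right; exists n1', n2.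
Qed.

(** * Parity and size bounds for paths and cycles *)

Section Bipartite.

Variables (G : sgraph) (f : G -> bool).
Hypothesis f_adj : forall x y, adj x y -> f x != f y.

Lemma bipartite_path x p : path adj x p -> odd (size p) = f x (+) f (last x p).
Proof.
elim: p x => [|y p IH] x /=; first by rewrite addbb.
by case/andP=> /f_adj xy /IH ->; move: xy; case: (f x); case: (f y); case: (f _).
Qed.

Lemma bipartite_spath x y n : spath x y n -> odd n = (f x == f y).
Proof.
by case=> p [/bipartite_path + <- _ ->] /= => ->; case: (f x); case: (f _).
Qed.

Lemma bipartite_cycle n : has_cycle G n -> ~~ odd n.
Proof.
case=> -[|x p] [// _ /andP[/= + _]] ->.
rewrite rcons_path => /andP[/bipartite_path /= -> /f_adj].
by case: (f x); case: (f _).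
Qed.

End Bipartite.

Lemma spath_leq_card (G : sgraph) (x y : G) n : spath x y n -> n <= #|G|.
Proof. by case=> p [_ _ up ->]; have := max_card [in x :: p]; rewrite (card_uniqP up). Qed.

Lemma cycle_leq_card (G : sgraph) n : has_cycle G n -> 2 < n <= #|G|.
Proof. by case=> c [sc /andP[_ uc]] ->; rewrite sc; have := max_card [in c]; rewrite (card_uniqP uc). Qed.

Lemma spath_nonadj (G : sgraph) (x y : G) n : x != y -> ~~ adj x y -> spath x y n -> 2 < n.
Proof.
move=> xy nadj [[|z [|z' p]] [pp lp _ ->]] //=; move: lp => /= e.
  by rewrite e eqxx in xy.
by move: pp; rewrite /= e (negbTE nadj).
Qed.

(** * Attaching a gadget to a 4-cycle *)

(** The 4-cycle is taken as $K_{2,2}$: opposite vertices share their first component. *)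
Definition square_adj : rel (bool * bool) := [rel x y | x.1 != y.1].

Lemma square_adj_sym : symmetric square_adj.
Proof. by move=> x y; rewrite /square_adj /= eq_sym. Qed.

Lemma square_adj_irrefl : irreflexive square_adj.
Proof. by move=> x; rewrite /square_adj /= eqxx. Qed.

Definition square_graph : sgraph := SGraph square_adj_sym square_adj_irrefl.

Definition square_gadget : gadget :=
  @Gadget square_graph (false, false) (false, true) isT.

Definition cross (A : gadget) : gadget :=
  @glue square_gadget A (true, false) (true, true).

Lemma card_square : #|square_graph| = 4.
Proof. by rewrite card_prod card_bool. Qed.

(** Ends on the same side force an odd number of vertices, and only 3 and 4 are possible by
    nonadjacency and size. *)
Lemma square_spath (x y : square_graph) n : x.1 = y.1 -> x != y -> spath x y n -> n = 3.
Proof.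
move=> xy nxy H; have := spath_leq_card H; rewrite card_square.
have := @bipartite_spath square_graph fst (fun u v uv => uv) _ _ _ H.
have : 2 < n by apply: spath_nonadj H; rewrite //= /square_adj /= xy eqxx.
by rewrite xy eqxx; case: n {H} => [|[|[|[|[|n]]]]].
Qed.

Lemma square_cycle n : has_cycle square_graph n -> n = 4.
Proof.
move=> H; have := cycle_leq_card H; rewrite card_square.
have := @bipartite_cycle square_graph fst (fun u v uv => uv) _ H.
by case: n {H} => [|[|[|[|[|n]]]]].
Qed.

Lemma sum_pair (I J : finType) (F : I * J -> nat) : \sum_x F x = \sum_i \sum_j F (i, j).
Proof. by rewrite pair_bigA; apply: eq_bigr => -[]. Qed.

Lemma cross_cubic_gadget A : cubic_gadget A -> cubic_gadget (cross A).
Proof.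
by apply: glue_cubic_gadget => // -[x y]; rewrite card_neighbours sum_pair !big_bool /= ?big_bool; case: x; case: y.
Qed.

Lemma cross_2conn A : gadget_2conn A -> gadget_2conn (cross A).
Proof.
apply: glue_2conn => //; split.
- by apply: (@connect_trans _ _ (true, true)); apply: connect1; rewrite /frame_adj /= !inE.
- move=> X [[] i] cX yX; last first.
    by exists (false, i) => //; case: i yX => //= yX; rewrite !inE.
  have [u Hu uX] : exists2 u : square_graph, u \in [:: (false, false); (false, true)] & u \notin X.
    case: (boolP ((false, false) \in X)) => [sX|]; last by exists (false, false); rewrite ?inE.
    exists (false, true); rewrite ?inE //; apply/negP => tX.
    by have := card_le1_eqP cX _ _ sX tX.
  exists u => //; split=> //; apply: connect1; rewrite /frame_adj /= yX uX.
  by move: Hu; rewrite !inE => /orP[]/eqP->.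
- move=> [[] i]; last by exists (false, i) => //; case: i; rewrite !inE.
  by exists (false, false); rewrite ?inE //; apply: connect1.
Qed.

Lemma cross_spath A n : @spath (cross A) src tgt n ->
  n = 3 \/ exists2 n', @spath A src tgt n' & n = 4 + n'.
Proof.
case/(glue_spath_four _ (src_neq_tgt A) card_square) => //; last by right.
by move/square_spath => ->; [left| |].
Qed.

Lemma cross_cycle A n : has_cycle (cross A) n ->
  [\/ n = 4, has_cycle A n | exists2 n', @spath A src tgt n' & n = 3 + n'].
Proof.
case/(glue_cycle _ (src_neq_tgt A)) => // [/square_cycle| |]; [by constructor 1|by constructor 2|].
case=> n1 [n2 [/square_spath -> // H2 ->]]; constructor 3; by exists n2.
Qed.

(** * The building blocks of the initial gadgets *)

(** This is $K_4$ without the edge between the two vertices with first component [false], which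
    become the terminals. *)
Definition diamond_adj : rel (bool * bool) := [rel x y | (x != y) && (x.1 || y.1)].

Lemma diamond_adj_sym : symmetric diamond_adj.
Proof. by move=> x y; rewrite /diamond_adj /= eq_sym orbC. Qed.

Lemma diamond_adj_irrefl : irreflexive diamond_adj.
Proof. by move=> x; rewrite /diamond_adj /= eqxx. Qed.

Definition diamond : gadget :=
  @Gadget (SGraph diamond_adj_sym diamond_adj_irrefl) (false, false) (false, true) isT.

Lemma card_diamond : #|diamond| = 4.
Proof. by rewrite card_prod card_bool. Qed.

Lemma diamond_spath n : @spath diamond src tgt n -> n = 3 \/ n = 4.
Proof.
move=> H; have := spath_leq_card H; rewrite card_diamond.
have : 2 < n by apply: spath_nonadj H.
lia.
Qed.

Lemma diamond_cycle n : has_cycle diamond n -> n = 3 \/ n = 4.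
Proof. by move/cycle_leq_card; rewrite card_diamond; lia. Qed.

Lemma diamond_cubic_gadget : cubic_gadget diamond.
Proof. by move=> -[x y]; rewrite card_neighbours sum_pair !big_bool /= ?big_bool; case: x; case: y. Qed.

Lemma diamond_2conn : gadget_2conn diamond.
Proof.
split.
  by apply: (@connect_trans diamond _ (true, true)); apply: connect1.
move=> X [[] i] cX yX; last first.
  by exists (false, i) => //; case: i yX => //= yX; rewrite !inE.
have [u Hu uX] : exists2 u : diamond, u \in [:: src; tgt] & u \notin X.
  case: (boolP (@src diamond \in X)) => [sX|]; last by exists src; rewrite ?inE.
  exists tgt; rewrite ?inE //; apply/negP => tX.
  by have := card_le1_eqP cX _ _ sX tX.
exists u => //; split=> //; apply: connect1; rewrite /adj_minus /= yX uX.
by move: Hu; rewrite !inE => /orP[]/eqP->.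
Qed.

(* K_{3,3} minus an edge *)
Definition k33_adj : rel (bool * 'I_3) :=
  [rel x y | (x.1 != y.1) && ((x.2 != ord0) || (y.2 != ord0))].

Lemma k33_adj_sym : symmetric k33_adj.
Proof. by move=> x y; rewrite /k33_adj /= eq_sym orbC. Qed.

Lemma k33_adj_irrefl : irreflexive k33_adj.
Proof. by move=> x; rewrite /k33_adj /= eqxx. Qed.

Definition k33 : gadget :=
  @Gadget (SGraph k33_adj_sym k33_adj_irrefl) (false, ord0) (true, ord0) isT.

Lemma card_k33 : #|k33| = 6.
Proof. by rewrite card_prod card_bool card_ord. Qed.

Lemma k33_bipartite (x y : k33) : adj x y -> x.1 != y.1.
Proof. by case/andP. Qed.

(** The terminals are nonadjacent and on opposite sides, so the number of vertices is even, above 2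
    and at most 6. *)
Lemma k33_spath n : @spath k33 src tgt n -> n = 4 \/ n = 6.
Proof.
move=> H; have := spath_leq_card H; rewrite card_k33.
have : 2 < n by apply: spath_nonadj H.
have /= := bipartite_spath k33_bipartite H.
lia.
Qed.

Lemma k33_cycle n : has_cycle k33 n -> n = 4 \/ n = 6.
Proof.
move=> H; have := cycle_leq_card H; rewrite card_k33.
have /= := bipartite_cycle k33_bipartite H.
lia.
Qed.

Lemma k33_cubic_gadget : cubic_gadget k33.
Proof.
move=> -[x y]; rewrite card_neighbours.
rewrite sum_pair big_bool /=.
rewrite !big_ord_recl !big_ord0.
by case: x; case: y => -[|[|[|i]]].
Qed.

Lemma k33_2conn : gadget_2conn k33.
Proof.
split.
  apply: (@connect_trans k33 _ (true, inord 1)); first by apply: connect1; rewrite /= /k33_adj /= -val_eqE /= inordK.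
  apply: (@connect_trans k33 _ (false, inord 1)); apply: connect1; by rewrite /= /k33_adj /= -!val_eqE /= !inordK.
move=> X [i j] cX yX.
have [j0|j0] := eqVneq j ord0.
  by subst j; exists (i, ord0) => //; case: i {yX}; rewrite !inE.
(* If the terminal on the other side survives, it is a neighbour. Otherwise it is the only deleted
   vertex, and [(~~ i, j)] leads to the terminal on the same side. *)
case: (boolP ((~~ i, ord0) \in X)) => [zX|zX]; last first.
  exists (~~ i, ord0); first by case: i {yX zX}; rewrite !inE.
  split=> //; apply: connect1; rewrite /adj_minus /= yX zX /k33_adj /= j0.
  by case: i {yX zX}.
have notX u : u != (~~ i, ord0) -> u \notin X.
  by apply: contra => uX; apply/eqP; apply: (card_le1_eqP cX).
have tX : (i, ord0) \notin X by apply: notX; case: i {yX zX}.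
exists (i, ord0); first by case: i {yX zX notX tX}; rewrite !inE.
split=> //.
have wX : (~~ i, j) \notin X by apply: notX; rewrite xpair_eqE (negbTE j0) andbF.
apply: (@connect_trans k33 _ (~~ i, j)); apply: connect1;
  by rewrite /adj_minus /= ?yX ?wX ?tX /k33_adj /= j0 ?orbT andbT; case: i {yX zX notX tX wX}.
Qed.

(** * Iteration and residues modulo 3 *)

Definition nearly_div3 (z : nat) (A : gadget) : Prop :=
  forall n, @spath A src tgt n -> 3 %| n \/ n = z.

Definition step (A : gadget) : gadget := cross (wrap true A).

Lemma step_nearly_div3 z A : nearly_div3 z A -> nearly_div3 (6 + z) (step A).
Proof.
move=> Hz n /cross_spath[->|[n1 /wrap_spath[[_ ->]|[n2 /Hz H2 ->]] ->]]; [by left|by left|].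
by case: H2 => [H2|->]; [left|right]; lia.
Qed.

Lemma step_2conn A : gadget_2conn A -> gadget_2conn (step A).
Proof. by move/(wrap_2conn true)/cross_2conn. Qed.

Lemma step_cubic_gadget A : cubic_gadget A -> cubic_gadget (step A).
Proof. by move/wrap_cubic_gadget/cross_cubic_gadget. Qed.

Lemma card_step (A : gadget) : #|A| < #|step A|.
Proof. by rewrite card_glue card_square card_wrap; lia. Qed.

Definition chain (D : gadget) (n : nat) : gadget := iter n step (double D).

Section ModularLengths.

Variables (m k : nat).
Hypotheses (hm3 : 3 %| m) (hk3 : 3 %| k).

Definition avoids (G : sgraph) : Prop :=
  forall n, has_cycle G n -> n <> m %[mod k].

(** Since 3 divides [k], reduction modulo [k] keeps the residue modulo 3, and that of [m] is 0. *)
Lemma neq_mod_of_ndvd3 n : ~~ (3 %| n) -> n <> m %[mod k].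
Proof.
move=> n3 e; case/negP: n3; rewrite /dvdn -(modn_dvdm n hk3) e (modn_dvdm m hk3).
exact: hm3.
Qed.

(** With every terminal path length l congruent to 0 or 2 modulo 3, the new cycle lengths 4, 2 + l,
    5 and 5 + l are all congruent to 1 or 2. *)
Lemma step_avoids z A : z %% 3 = 2 -> nearly_div3 z A -> avoids A -> avoids (step A).
Proof.
move=> z3 Hz HA n /cross_cycle[->|/wrap_cycle[/HA//|[_ [n1 /Hz H1 ->]]]|].
- exact: neq_mod_of_ndvd3.
- by apply: neq_mod_of_ndvd3; case: H1 => [|->]; lia.
- case=> n1 /wrap_spath[[_ ->]|[n2 /Hz H2 ->]] ->; apply: neq_mod_of_ndvd3 => //.
  by case: H2 => [|->]; lia.
Qed.

Section Chain.

Variables (D : gadget) (z : nat).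
Hypotheses (D_cubic : cubic_gadget D) (D_2conn : gadget_2conn D).
Hypotheses (z3 : z %% 3 = 2) (D_path : nearly_div3 z (double D)).
Hypothesis D_avoids : avoids (double D).

Lemma chain_cubic n : cubic_gadget (chain D n).
Proof. by elim: n => [|n IH]; [apply: double_cubic_gadget|apply: step_cubic_gadget]. Qed.

Lemma chain_2conn n : gadget_2conn (chain D n).
Proof. by elim: n => [|n IH]; [apply: double_2conn|apply: step_2conn]. Qed.

Lemma card_chain n : n <= #|chain D n|.
Proof. by elim: n => // n IH; apply: leq_ltn_trans IH _; apply: card_step. Qed.

Lemma chain_nearly_div3 n : nearly_div3 (6 * n + z) (chain D n).
Proof.
elim: n => [|n IH]; first by rewrite muln0.
by rewrite mulnS -addnA; apply: step_nearly_div3.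
Qed.

Lemma chain_avoids n : avoids (chain D n).
Proof.
elim: n => // n IH; apply: step_avoids IH; last exact: chain_nearly_div3.
by lia.
Qed.

Lemma ring_of_chain n : 6 * n + 2 * z + 2 <> m %[mod k] ->
  exists G : sgraph,
    [/\ vertex_connected 2 G, cubic G, n <= #|G|
      & forall c : seq G, is_cycle c -> size c <> m %[mod k]].
Proof.
move=> Hn; exists (glue (wrap true (chain D n)) (@src (double D)) tgt); split.
- by apply: glue_vertex_connected; [apply: double_2conn|apply/wrap_2conn/chain_2conn].
- by apply: glue_cubic; [apply: double_cubic_gadget|apply/wrap_cubic_gadget/chain_cubic].
- by rewrite card_glue card_wrap; have := card_chain n; lia.
move=> c Hc.
have : has_cycle (glue (wrap true (chain D n)) (@src (double D)) tgt) (size c) by exists c.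
case/(glue_cycle (src_neq_tgt _) (src_neq_tgt _)).
- exact: D_avoids.
- case/wrap_cycle=> [|[_ [n1 /chain_nearly_div3 H1 ->]]]; first exact: chain_avoids.
  by apply: neq_mod_of_ndvd3; case: H1 => [|->]; lia.
case=> n1 [n2 [/D_path H1 /wrap_spath H2 ->]].
case: H2 => [[_ ->]|[n3 /chain_nearly_div3 H3 ->]].
  by apply: neq_mod_of_ndvd3; case: H1 => [|->]; lia.
(* The length is [n1 + 2 + n3] with [n1], [n3] congruent to 0 or 2 modulo 3, so it is divisible by 3
   only if both take their exceptional value. *)
case: H1 H3 => [d1|->] [d3|->]; try by apply: neq_mod_of_ndvd3; lia.
by rewrite (_ : z + _ = 6 * n + 2 * z + 2) //; lia.
Qed.

End Chain.

End ModularLengths.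

Theorem theorem6p4 (m k N : nat) (hk : 12 <= k) (hm3 : 3 %| m) (hk3 : 3 %| k) :
  exists G : sgraph,
    [/\ vertex_connected 2 G,
        cubic G,
        N <= #|G|
      & forall c : seq G, is_cycle c -> size c <> m %[mod k]].
Proof.
have weaken n : N <= n -> (exists G : sgraph, [/\ vertex_connected 2 G, cubic G, n <= #|G|
      & forall c : seq G, is_cycle c -> size c <> m %[mod k]]) -> exists G : sgraph,
    [/\ vertex_connected 2 G, cubic G, N <= #|G|
      & forall c : seq G, is_cycle c -> size c <> m %[mod k]].
  by move=> Nn [G [G1 G2 G3 G4]]; exists G; split=> //; apply: leq_trans G3.
have small c : c < 12 -> c %% k = c by move=> c12; rewrite modn_small //; lia.
(* The bound on [k] makes every length below 12 its own residue; 12 itself becomes 0 exactly when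
   [k] is 12. *)
have mod12 : 12 %% k = 0 \/ 12 %% k = 12.
  by move: hk; rewrite leq_eqVlt => /orP[/eqP<-|?]; [left|right; rewrite modn_small].
have r3 : 3 %| m %% k by rewrite /dvdn modn_dvdm.
have kN : N <= k * N by rewrite leq_pmull //; lia.
have kN1 : N <= (k * N.+1).-1 by rewrite mulnS; lia.
(* Two numbers of steps are used, one congruent to -1 and one to 0 modulo [k], so that [6 * n]
   becomes -6 or 0. *)
have E1 c : 6 * (k * N.+1).-1 + (c + 6) = c %[mod k].
  rewrite (_ : _ + _ = (6 * N.+1) * k + c) ?modnMDl //.
  by rewrite -mulnA [_ * k]mulnC; have : 0 < k * N.+1; lia.
have E0 c : 6 * (k * N) + c = c %[mod k].
  by rewrite mulnCA mulnC modnMDl.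
(* The double diamond has cycles of lengths 3 and 9, which rules it out for these residues. For the
   double of [k33] the lengths divisible by 3 are 6 and 12, with residue 6, 0 or 12, and the ring
   adds 6n + 18, which is 12 modulo [k] for n congruent to -1. *)
have [r39|r39] := boolP ((m %% k == 3) || (m %% k == 9)).
  apply: (weaken _ kN1).
  apply: (ring_of_chain hm3 hk3 k33_cubic_gadget k33_2conn (z := 8)) => //.
  - by move=> n /double_spath[n' /k33_spath[]-> ->]; [left|right].
  - move=> n /double_cycle[/k33_cycle[]->|[n1 [n2 [/k33_spath H1 /k33_spath H2 ->]]]].
    + exact: neq_mod_of_ndvd3.
    + by rewrite small //; lia.
    + case: H1 H2 => -> [] ->; try exact: neq_mod_of_ndvd3.
      * by rewrite add2n; lia.
      * by lia.
  - by rewrite -addnA (E1 12); lia.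
have cyc n : has_cycle (double diamond) n -> n <> m %[mod k].
  move=> /double_cycle[/diamond_cycle[]->|[n1 [n2 [/diamond_spath H1 /diamond_spath H2 ->]]]].
  - by rewrite small //; lia.
  - exact: neq_mod_of_ndvd3.
  - case: H1 H2 => -> [] ->; try exact: neq_mod_of_ndvd3.
    + by rewrite small //; lia.
    + by rewrite small //; lia.
have pth : nearly_div3 5 (double diamond).
  by move=> n /double_spath[n' /diamond_spath[]-> ->]; [right|left].
(* With [z = 5] the ring length is 6n + 12: n congruent to -1 gives residue 6, and when that is the
   forbidden one, n congruent to 0 gives the residue of 12. *)
have [r6|r6] := eqVneq (m %% k) 6.
  apply: (weaken _ kN).
  apply: (ring_of_chain hm3 hk3 diamond_cubic_gadget diamond_2conn (z := 5)) => //.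
  by rewrite -addnA E0 /=; lia.
apply: (weaken _ kN1).
apply: (ring_of_chain hm3 hk3 diamond_cubic_gadget diamond_2conn (z := 5)) => //.
by rewrite -addnA (E1 6) small //; lia.
Qed.
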